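(* Let $(\mathcal{A},\mathcal{H},D)$ be an equivariant odd spectral triple. Then $D$ cannot be $p$-summable for $p<3$ ($p>0$).
   Context: Fix a real number $q\in(0,1)$. $\mathcal{A}=C(SU_q(2))$ is the $C^*$-algebra generated by $\alpha,\beta$ subject to $\alpha^*\alpha+\beta^*\beta=I$, $\alpha\alpha^*+q^2\beta\beta^*=I$, $\alpha\beta-q\beta\alpha=0$, $\alpha\beta^*-q\beta^*\alpha=0$, $\beta^*\beta=\beta\beta^*$; $\mathcal{A}_f$ is the dense $*$-subalgebra generated by $\alpha,\beta$. $\mathcal{H}$ is the GNS space of the (faithful) Haar state of $\mathcal{A}$. It has an orthonormal basis $\{e^{(n)}_{ij}: n=0,\frac12,1,\ldots;\ i,j=-n,-n+1,\ldots,n\}$ (normalized matrix entries of the irreducible representations), and $\mathcal{A}$ acts faithfully on $\mathcal{H}$ by $$\alpha e^{(n)}_{ij}=a_+(n,i,j)e^{(n+1/2)}_{i-1/2,j-1/2}+a_-(n,i,j)e^{(n-1/2)}_{i-1/2,j-1/2},\quad \beta e^{(n)}_{ij}=b_+(n,i,j)e^{(n+1/2)}_{i+1/2,j-1/2}+b_-(n,i,j)e^{(n-1/2)}_{i+1/2,j-1/2},$$ $$a_+=\Bigl(q^{2(n+i)+2(n+j)+2}\tfrac{(1-q^{2n-2j+2})(1-q^{2n-2i+2})}{(1-q^{4n+2})(1-q^{4n+4})}\Bigr)^{1/2},\quad a_-=\Bigl(\tfrac{(1-q^{2n+2j})(1-q^{2n+2i})}{(1-q^{4n})(1-q^{4n+2})}\Bigr)^{1/2},$$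 $$b_+=-\Bigl(q^{2(n+j)}\tfrac{(1-q^{2n-2j+2})(1-q^{2n+2i+2})}{(1-q^{4n+2})(1-q^{4n+4})}\Bigr)^{1/2},\quad b_-=\Bigl(q^{2(n+i)}\tfrac{(1-q^{2n+2j})(1-q^{2n-2i})}{(1-q^{4n})(1-q^{4n+2})}\Bigr)^{1/2},$$ where terms involving basis vectors with indices out of range are zero. Odd spectral triple: $(\mathcal{A},\mathcal{H},D)$ is an odd spectral triple if $D$ is self-adjoint on $\mathcal{H}$, has compact resolvent, and $[D,a]$ is bounded for all $a\in\mathcal{A}_f$. Equivariance: let $A_0 e^{(n)}_{ij}=q^je^{(n)}_{ij}$, and $A_1e^{(n)}_{ij}=(q^{-2n}+q^{2n+2}-q^{-2j}-q^{2j+2})^{1/2}e^{(n)}_{i,j+1}$ if $j<n$, $A_1e^{(n)}_{in}=0$. An operator is equivariant if it commutes with $A_0,A_1,A_1^*$. Standing convention: the equivariant self-adjoint operators with discrete spectrum under consideration are those of the form $e^{(n)}_{ij}\mapsto d(n,i)e^{(n)}_{ij}$ with $d(n,i)$ real (the self-adjoint diagonal operator with these eigenvalues). The spectral triple is equivariant if $D$ is equivariant in this sense. $p$-summability: $D$ is $p$-summable if $|D|^{-p}$ (inverse taken on the orthogonal complement of the finite-dimensional kernel) lies in $\mathcal{L}^{(1,\infty)}$, the ideal of compact operators whose singular values $\mu_1\ge\mu_2\ge\cdots$ satisfy $\sum_{k=1}^N\mu_k=O(\log N)$. *)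

(* Defs.v *)
From HB Require Import structures.
From mathcomp Require Import all_boot all_order all_algebra.
From mathcomp Require Import sesquilinear complex.
From mathcomp Require Import all_classical all_reals all_analysis.
Import Order.TTheory GRing.Theory Num.Theory.
Import numFieldNormedType.Exports.

Set Implicit Arguments.
Unset Strict Implicit.
Unset Printing Implicit Defensive.

Local Open Scope classical_set_scope.
Local Open Scope ring_scope.
Local Open Scope complex_scope.

(** A complex Hilbert space is a Banach space [H] over [R[i]] together with an
    inner product [dot] (linear in its first argument, conjugate-linear in the
    second one) which induces the norm of [H]. *)

Section HilbertSpace.
Context (R : realType) (H : completeNormedModType R[i]).
Variable dot : {dot H for (@Num.conj R[i])}.

Definition induces_norm : Prop := forall x : H, `|x| ^+ 2 = dot x x.

Definition is_adjoint (a b : H -> H) : Prop :=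
  forall x y, dot (a x) y = dot x (b y).

Definition positive_operator (P : H -> H) : Prop :=
  forall x, 0 <= dot (P x) x.

Definition compact_operator (T : H -> H) : Prop :=
  compact (closure (T @` [set x | `|x| <= 1])).

(** Unbounded operators are given by their graph: [D (x, y)] means that [x] is
    in the domain of [D] and that [D x = y]. *)

Definition dom (D : set (H * H)) : set H := [set x | exists y, D (x, y)].

Definition adjoint (D : set (H * H)) : set (H * H) :=
  [set xy | forall u v, D (u, v) -> dot v xy.1 = dot u xy.2].

(* When [dom D] is dense, [adjoint D] is the graph of a linear operator; hence
   so is [D] if it is equal to its adjoint. *)
Definition self_adjoint (D : set (H * H)) : Prop :=
  dense (dom D) /\ adjoint D = D.

(* [T] is the everywhere defined inverse of [D - l]. *)
Definition is_resolvent (D : set (H * H)) (l : R[i]) (T : H -> H) : Prop :=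
  (forall x, D (T x, x + l *: T x)) /\
  (forall u v, D (u, v) -> T (v - l *: u) = u).

Definition has_compact_resolvent (D : set (H * H)) : Prop :=
  exists (l : R[i]) (T : {linear H -> H}),
    [/\ continuous T, is_resolvent D l T & compact_operator T].

(* The graph of [D a - a D], on its natural domain
   {x \in dom D | a x \in dom D}. *)
Definition commutator (D : set (H * H)) (a : H -> H) : set (H * H) :=
  [set xz | exists y w, [/\ D (xz.1, y), D (a xz.1, w) & xz.2 = w - a y]].

Definition bounded_commutator (D : set (H * H)) (a : H -> H) : Prop :=
  dense (dom (commutator D a)) /\
  exists C : R, forall x z, commutator D a (x, z) -> `|z| <= C%:C * `|x|.

Definition odd_spectral_triple (Af : set (H -> H)) (D : set (H * H)) : Prop :=
  [/\ self_adjoint D,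
      has_compact_resolvent D &
      forall a, Af a -> bounded_commutator D a].

(** [P] is the absolute value of the bounded operator [T], that is, the
    positive square root of [T^* T]. *)
Definition is_abs (T : H -> H) (P : {linear H -> H}) : Prop :=
  [/\ continuous P, positive_operator P &
      exists2 S : H -> H, is_adjoint T S & forall x, P (P x) = S (T x)].

Definition orthonormal_seq (f : nat -> H) : Prop :=
  forall k l, dot (f k) (f l) = (k == l)%:R.

(** [mu] lists the eigenvalues of [|T|], with multiplicity, in nonincreasing
    order (followed by zeros if [T] has finite rank); [f] lists corresponding
    eigenvectors. *)
Definition singular_values (T : H -> H) (mu : nat -> R) : Prop :=
  exists (P : {linear H -> H}) (f : nat -> H),
    [/\ is_abs T P,
        orthonormal_seq f,
        (forall k, P (f k) = (mu k)%:C *: f k),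
        (forall x, (forall k, dot x (f k) = 0) -> P x = 0) &
        (forall k, 0 <= mu k.+1 <= mu k)].

Definition L1oo (T : H -> H) : Prop :=
  compact_operator T /\
  exists2 mu : nat -> R, singular_values T mu &
    (fun N : nat => \sum_(k < N) mu k : R^o) =O_\oo
    (fun N : nat => ln N%:R : R^o).

(** [T] is [|D|^-p], the inverse being taken on the orthogonal complement of
    the kernel of [D]. The eigenvectors of a self-adjoint [D] with compact
    resolvent span a dense subspace, so that the functional calculus is given
    by the action on them. *)
Definition is_abs_negpow (D : set (H * H)) (p : R) (T : H -> H) : Prop :=
  forall (l : R) (x : H), D (x, l%:C *: x) ->
    T x = (if l == 0 then 0 else `|l| `^ (- p))%:C *: x.

Definition p_summable (D : set (H * H)) (p : R) : Prop :=
  exists T : {linear H -> H},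
    [/\ continuous T, is_abs_negpow D p T & L1oo T].

End HilbertSpace.

(** Half-integers are represented by their doubles: below, the integers
    [n], [i], [j] stand for [2n], [2i], [2j] in the usual notation
    [e^(n)_(i,j)]; so a shift by 1/2 becomes a shift by 1, and for instance
    the exponent [4n+2] becomes [2 * n + 2]. *)

Section QuantumSU2.
Context (R : realType).

Definition valid_index (n i j : int) : bool :=
  [&& `|i| <= n, `|j| <= n, (2 %| n - i)%Z & (2 %| n - j)%Z].

Variable q : R.

Definition a_plus (n i j : int) : R :=
  Num.sqrt (q ^ ((n + i) + (n + j) + 2) *
            ((1 - q ^ (n - j + 2)) * (1 - q ^ (n - i + 2)) /
             ((1 - q ^ (2 * n + 2)) * (1 - q ^ (2 * n + 4))))).

Definition a_minus (n i j : int) : R :=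
  Num.sqrt ((1 - q ^ (n + j)) * (1 - q ^ (n + i)) /
            ((1 - q ^ (2 * n)) * (1 - q ^ (2 * n + 2)))).

Definition b_plus (n i j : int) : R :=
  - Num.sqrt (q ^ (n + j) *
              ((1 - q ^ (n - j + 2)) * (1 - q ^ (n + i + 2)) /
               ((1 - q ^ (2 * n + 2)) * (1 - q ^ (2 * n + 4))))).

Definition b_minus (n i j : int) : R :=
  Num.sqrt (q ^ (n + i) *
            ((1 - q ^ (n + j)) * (1 - q ^ (n - i)) /
             ((1 - q ^ (2 * n)) * (1 - q ^ (2 * n + 2))))).

Context (H : completeNormedModType R[i]).
Variable dot : {dot H for (@Num.conj R[i])}.

(* The last clause lets terms with indices out of range vanish in the formulas
   for [alpha] and [beta]. *)
Definition orthonormal_basis (e : int -> int -> int -> H) : Prop :=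
  [/\ (forall n i j n' i' j', valid_index n i j -> valid_index n' i' j' ->
         dot (e n i j) (e n' i' j') = ((n, i, j) == (n', i', j'))%:R),
      (forall x, (forall n i j, valid_index n i j -> dot x (e n i j) = 0) ->
         x = 0) &
      (forall n i j, ~~ valid_index n i j -> e n i j = 0)].

Variable e : int -> int -> int -> H.

(** The bounded operators by which the generators of C(SU_q(2)) act on the GNS
    space of the Haar state. *)
Definition suq2_generators (alpha beta : {linear H -> H}) : Prop :=
  [/\ continuous alpha, continuous beta,
      (forall n i j, valid_index n i j ->
         alpha (e n i j) =
           (a_plus n i j)%:C *: e (n + 1) (i - 1) (j - 1) +
           (a_minus n i j)%:C *: e (n - 1) (i - 1) (j - 1)) &
      (forall n i j, valid_index n i j ->
         beta (e n i j) =
           (b_plus n i j)%:C *: e (n + 1) (i + 1) (j - 1) +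
           (b_minus n i j)%:C *: e (n - 1) (i + 1) (j - 1))].

(** The *-subalgebra generated by [alpha] and [beta]; it contains the identity
    because of the relation [alpha^* alpha + beta^* beta = 1]. *)
Inductive star_algebra (alpha beta : H -> H) : (H -> H) -> Prop :=
  | star_algebra_alpha : star_algebra alpha beta alpha
  | star_algebra_beta : star_algebra alpha beta beta
  | star_algebra_add a b :
      star_algebra alpha beta a -> star_algebra alpha beta b ->
      star_algebra alpha beta (fun x => a x + b x)
  | star_algebra_scale (c : R[i]) a :
      star_algebra alpha beta a -> star_algebra alpha beta (fun x => c *: a x)
  | star_algebra_mul a b :
      star_algebra alpha beta a -> star_algebra alpha beta b ->
      star_algebra alpha beta (fun x => a (b x))
  | star_algebra_adj a b :
      star_algebra alpha beta a -> is_adjoint dot a b ->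
      star_algebra alpha beta b.

(** The operator [e^(n)_(i,j) |-> d(n,i) e^(n)_(i,j)] on its maximal domain
    (those [x] for which the coefficients [d(n,i) <x, e^(n)_(i,j)>] are those of
    a vector of [H]). *)
Definition diagonal_operator (d : int -> int -> R) : set (H * H) :=
  [set xy | forall n i j, valid_index n i j ->
     dot xy.2 (e n i j) = (d n i)%:C * dot xy.1 (e n i j)].

(** Commuting with the action of the generators of U_q(su(2)) (which only
    changes the index [j]) amounts, for self-adjoint operators diagonal in the
    basis [e], to the eigenvalues being independent of [j]. *)
Definition equivariant (D : set (H * H)) : Prop :=
  exists d : int -> int -> R, D = diagonal_operator d.

End QuantumSU2.

(* Main.v *)
Require Import Defs.
From mathcomp Require Import all_boot all_order all_algebra.
From mathcomp Require Import sesquilinear complex.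
From mathcomp Require Import all_classical all_reals all_analysis.
From mathcomp Require Import zify ring lra.
Import Order.TTheory GRing.Theory Num.Theory.
Import numFieldNormedType.Exports.

Local Open Scope classical_set_scope.
Local Open Scope ring_scope.
Local Open Scope complex_scope.

(** Equivariance makes [D] diagonal, with eigenvalues [d n i] independent of
    [j]. In the coordinates [k = n + i], [l = n - i] (with half-integers [n],
    [i], [j]), boundedness of [[D, beta]], tested at [j = - n] where the
    coefficient [b_plus] is bounded below, says that [d] changes by at most a
    constant when [k] increases by one. Boundedness of [[D, alpha]] gives the
    same in the direction of [l], but only where [a_plus] is bounded below, and
    [a_plus] decays like [q] to the power [k]; the boundary [k = 0] is enough.
    Walking from the origin along [k = 0] and then in the direction of [k]
    reaches every index, hence [|d n i|] grows at most linearly in [n]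
    ([linear_growth]).

    On the other hand each [n] carries [(2 n + 1) ^ 2] basis vectors, so about
    [L ^ 3] of them have an eigenvalue of size [O(L)]; they are not in the kernel
    once [n] is large, because a compact resolvent forces the kernel to be finite
    dimensional ([eigenvalue_eventually_neq0]). So at least [L ^ 3] singular
    values of [|D|^-p] are above a multiple of [L ^ - p] ([singular_value_ge]),
    and their sum is at least of order [L ^ (3 - p)]. For [p < 3] this is not
    [O(ln L)] ([cubic_decay_not_logarithmic]).

    The comparison of the abstract list of singular values with the diagonal
    entries is a double count: orthonormal eigenvectors of [|T|] with eigenvalues
    at least [c] lie in the span of those [f k] with [mu k >= c], and Bessel's
    inequality bounds the size of an orthonormal family in such a span. *)

(** * Orthonormal families *)

Section HilbertSpace.
Context {R : realType} {H : completeNormedModType R[i]}.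
Variable dot : {dot H for (@Num.conj R[i])}.

Definition orthonormal_family {I : eqType} (g : I -> H) : Prop :=
  forall s t, dot (g s) (g t) = (s == t)%:R.

Lemma dotC x y : dot x y = (dot y x)^*%R.
Proof. by rewrite hermC expr0 mul1r. Qed.

Lemma dotZl a x y : dot (a *: x) y = a * dot x y.
Proof. exact: linearZl_LR. Qed.

Lemma dotZr a x y : dot x (a *: y) = a^*%R * dot x y.
Proof. exact: linearZr_LR. Qed.

Lemma dot_suml {I : finType} (E : I -> H) y :
  dot (\sum_s E s) y = \sum_s dot (E s) y.
Proof. exact: linear_sumlz. Qed.

Lemma dot_sumr {I : finType} (E : I -> H) x :
  dot x (\sum_s E s) = \sum_s dot x (E s).
Proof. exact: linear_sumr. Qed.

Lemma bessel_inequality {I : finType} {g : I -> H} (x : H) :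
  orthonormal_family g -> \sum_s `|dot x (g s)| ^+ 2 <= dot x x.
Proof.
move=> hg; set B := \sum_s _.
pose y := \sum_s dot x (g s) *: g s.
have yg s : dot y (g s) = dot x (g s).
  rewrite /y dot_suml (bigD1 s)//= big1 => [|t ts].
    by rewrite dotZl hg eqxx mulr1 addr0.
  by rewrite dotZl hg (negbTE ts) mulr0.
have By z : (forall s, dot z (g s) = dot x (g s)) -> dot z y = B.
  move=> hz; rewrite /y dot_sumr; apply: eq_bigr => s _.
  by rewrite dotZr hz normCK mulrC.
have := dnorm_ge0 dot (x - y).
rewrite linearBl !linearBr /= By// By// (dotC y x) By//.
have -> : B^*%R = B.
  by apply/CrealP/rpred_sum => s _; rewrite realX// normr_real.
by rewrite subrr subr0 subr_ge0.
Qed.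

(** Counting dimensions without ranks: each [g s] in the span of [f] has
    [\sum_k |dot (g s) (f k)| ^ 2 = 1]; sum over [s], exchange the sums, and apply
    Bessel's inequality to every [f k]. *)
Lemma orthonormal_card_le {I J : finType} {g : I -> H} {f : J -> H} :
  orthonormal_family g -> orthonormal_family f ->
  (forall s, g s = \sum_k dot (g s) (f k) *: f k) -> (#|I| <= #|J|)%N.
Proof.
move=> hg hf gf; rewrite -(ler_nat R[i]).
have gE s : 1 = \sum_k `|dot (g s) (f k)| ^+ 2.
  transitivity (dot (g s) (g s)); first by rewrite hg eqxx.
  rewrite [X in dot X _ = _]gf dot_suml; apply: eq_bigr => k _.
  by rewrite dotZl [dot (f k) _]dotC normCK.
have -> : #|I|%:R = \sum_(s : I) (1 : R[i]) by rewrite sumr_const.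
have -> : #|J|%:R = \sum_(k : J) (1 : R[i]) by rewrite sumr_const.
rewrite (eq_bigr _ (fun s _ => gE s)) exchange_big /=.
apply: ler_sum => k _.
have -> : 1 = dot (f k) (f k) by rewrite hf eqxx.
apply: le_trans (bessel_inequality (f k) hg).
by apply: ler_sum => s _; rewrite [dot (g s) _]dotC norm_conjC.
Qed.

(** * Singular values of a diagonal operator *)

Lemma dot_injr y z : (forall x, dot x y = dot x z) -> y = z.
Proof.
move=> yz; apply/eqP; rewrite -subr_eq0 -(dnorm_eq0 dot) linearBr /=.
by rewrite yz subrr.
Qed.

Lemma adjointZ T S c y : is_adjoint dot T S -> S (c *: y) = c *: S y.
Proof. by move=> TS; apply: dot_injr => x; rewrite -TS !dotZr TS. Qed.

Lemma conj_real_complex (a : R) : a%:C^*%R = a%:C.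
Proof. by apply: conj_Creal; apply/complex_realP; exists a. Qed.

(** Symmetry of [P ^ 2 = T^* T] follows at once from the adjunction, and it
    separates the eigenvectors of [P]: the eigenvalues being nonnegative, they are
    determined by their squares. *)
Lemma abs_sqr_selfadjoint T (P : {linear H -> H}) x y :
  is_abs dot T P -> dot (P (P x)) y = dot x (P (P y)).
Proof. by move=> [_ _ [S TS PP]]; rewrite !PP dotC -!TS -dotC. Qed.

Lemma abs_eigen_orthogonal T (P : {linear H -> H}) (a b : R) x y :
  is_abs dot T P -> P x = a%:C *: x -> P y = b%:C *: y ->
  0 <= a -> 0 <= b -> a != b -> dot x y = 0.
Proof.
move=> TP Px Py a0 b0 ab; have := abs_sqr_selfadjoint T P x y TP.
rewrite Px Py !linearZ /= Px Py !dotZl !dotZr !conj_real_complex !mulrA.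
rewrite -!rmorphM /= => /eqP; rewrite -subr_eq0 -mulrBl mulf_eq0 => /orP[|/eqP//].
by rewrite subr_eq0 -!expr2 => /eqP/complexI/eqP; rewrite eqrXn2// (negbTE ab).
Qed.

Section DiagonalOperator.
Context {I : eqType}.
Variable u : I -> H.
Hypothesis u_orthonormal : orthonormal_family u.
Hypothesis u_total : forall x, (forall t, dot x (u t) = 0) -> x = 0.
Variables (T : H -> H) (lam : I -> R).
Hypothesis T_diag : forall t, T (u t) = (lam t)%:C *: u t.

(** The entries are real and the [u t] form an orthonormal basis, so the
    adjoint has the same matrix. *)
Lemma adjoint_diag S t : is_adjoint dot T S -> S (u t) = (lam t)%:C *: u t.
Proof.
move=> TS; apply/eqP; rewrite -subr_eq0; apply/eqP/u_total => s.
rewrite linearBl /= dotZl [dot (S _) _]dotC -TS T_diag dotZl !u_orthonormal.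
rewrite rmorphM /= rmorph_nat conj_real_complex (eq_sym t s).
by case: eqVneq => [->|]; rewrite ?mulr0 subrr.
Qed.

(** Factor [P ^ 2 - lam ^ 2 = (P + lam) (P - lam)] on [u t]: the vector
    [w = (P - lam) (u t)] satisfies [P w = - lam w], which contradicts positivity
    of [P] unless [w = 0]. *)
Lemma abs_diag (P : {linear H -> H}) t :
  is_abs dot T P -> 0 < lam t -> P (u t) = (lam t)%:C *: u t.
Proof.
move=> [_ P0 [S TS PP]] lt0; set w := P (u t) - (lam t)%:C *: u t.
have Pw : P w = - ((lam t)%:C *: w).
  rewrite /w linearB linearZ /= PP T_diag (adjointZ _ _ _ _ TS) adjoint_diag//.
  by rewrite scalerBr opprB.
have := P0 w; rewrite Pw linearNl /= dotZl oppr_ge0 pmulr_rle0 ?ltcR// => w0.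
have /eqP : dot w w = 0 by apply/eqP; rewrite eq_le w0 dnorm_ge0.
by rewrite dnorm_eq0 subr_eq0 => /eqP.
Qed.

(** One half of the min-max principle. If [mu k < c], only the [f l] with
    [l < k] can meet the eigenvectors [u (h s)], whose eigenvalues are at least
    [c]; these eigenvectors then form an orthonormal family in the span of [k]
    vectors. *)
Lemma singular_value_ge {J : finType} (h : J -> I) (c : R) (mu : nat -> R) k :
  injective h -> 0 < c -> (forall s, c <= lam (h s)) ->
  singular_values dot T mu -> (k < #|J|)%N -> c <= mu k.
Proof.
move=> h_inj c0 lamc [P [f [TP hf Pf Pperp mu_mono]]] kJ.
rewrite leNgt; apply/negP => muc.
have mu0 l : 0 <= mu l by have /andP[m0 ml] := mu_mono l; apply: le_trans ml.
have mukc l : (k <= l)%N -> mu l < c.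
  elim: l => [|l IH]; first by rewrite leqn0 => /eqP <-.
  rewrite leq_eqVlt => /orP[/eqP <-//|/IH]; apply: le_lt_trans.
  by have /andP[] := mu_mono l.
move: kJ; rewrite ltnNge => /negP; apply.
rewrite -[X in (_ <= X)%N]card_ord.
apply: (@orthonormal_card_le _ _ (u \o h) (fun l : 'I_k => f l)).
- by move=> s t; rewrite /= u_orthonormal (inj_eq h_inj).
- by move=> l m; rewrite hf.
move=> s /=; set g := u (h s).
have lc0 : 0 < lam (h s) by apply: lt_le_trans (lamc s).
have Pg : P g = (lam (h s))%:C *: g by apply: abs_diag.
have gf l : (k <= l)%N -> dot g (f l) = 0.
  move=> kl; apply: (abs_eigen_orthogonal T P _ _ _ _ TP Pg (Pf l)) => //.
    exact: ltW.
  by rewrite gt_eqF// (lt_le_trans (mukc l kl)).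
pose y := \sum_(l < k) dot g (f l) *: f l.
(* [g - y] is orthogonal to all [f l], and [P] vanishes there; as [P g] is a
   nonzero multiple of [g], this recovers [g] itself from the [f l], [l < k]. *)
have : P (g - y) = 0.
  apply: Pperp => l; rewrite linearBl /= dot_suml.
  have [lk|kl] := ltnP l k; last first.
    rewrite gf// big1 ?subr0// => m _; rewrite dotZl hf ltn_eqF ?mulr0//.
    exact: leq_trans (ltn_ord m) kl.
  rewrite (bigD1 (Ordinal lk))//= big1 => [|m mk].
    by rewrite dotZl hf eqxx mulr1 addr0 subrr.
  by rewrite dotZl hf (_ : _ == _ = false) ?mulr0//; apply/negbTE.
rewrite linearB /= Pg /y linear_sum => /eqP; rewrite subr_eq0 => /eqP gE.
have /(congr1 ( *:%R (lam (h s))%:C^-1)) := gE.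
rewrite scalerA mulVf ?scale1r; last by rewrite gt_eqF// ltcR.
move=> {1}->; rewrite scaler_sumr; apply: eq_bigr => l _.
rewrite linearZ /= Pf !scalerA.
have [le|le] := eqVneq (lam (h s)) (mu l).
  rewrite le mulrC mulrA mulfV ?mul1r//.
  by rewrite gt_eqF// ltcR -le.
rewrite (abs_eigen_orthogonal T P _ _ _ _ TP Pg (Pf l)) ?mulr0 ?mul0r//.
exact: ltW.
Qed.

End DiagonalOperator.
End HilbertSpace.

(** * The kernel of an operator with compact resolvent *)

Section UnitVectors.
Context {R : realType} {H : completeNormedModType R[i]}.
Variable dot : {dot H for (@Num.conj R[i])}.
Hypothesis dot_norm : induces_norm dot.

Lemma norm_unit x : dot x x = 1 -> `|x| = 1.
Proof. by move=> xx; apply/eqP; rewrite -sqrp_eq1// dot_norm xx. Qed.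

Lemma dot_unit_le g z : dot g g = 1 -> `|dot z g| <= `|z|.
Proof.
move=> gg; rewrite -(@ler_pXn2r _ 2)// ?nnegrE// dot_norm.
have := @bessel_inequality _ _ dot unit (fun=> g) z.
by rewrite big_const cardE enumT unlock /= addr0; apply => -[] [].
Qed.

(** The resolvent at [l] multiplies every [w k] by [- l^-1]. A cluster point
    of the images is closer than [|l^-1| / 2] to the images of two orthogonal
    [w k], whereas these are at distance [sqrt 2 * |l^-1|] from each other. Asking
    only that each [w k] be orthogonal to all terms from some rank on spares the
    extraction of an orthonormal subsequence. *)
Lemma compact_resolvent_no_kernel_sequence (D : set (H * H)) (w : nat -> H) :
  has_compact_resolvent D -> (forall k, dot (w k) (w k) = 1) ->
  (forall k, D (w k, 0)) ->
  (forall k, exists N, forall l, (N <= l)%N -> dot (w k) (w l) = 0) -> False.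
Proof.
move=> [l [T [_ [_ TD] Tcpt]]] w1 Dw w_orth.
have Tlw k : T (- (l *: w k)) = w k by rewrite -sub0r TD.
have l0 : l != 0.
  apply/eqP => l0; have := w1 0%N.
  rewrite -(Tlw 0%N) l0 scale0r oppr0 !linear0 => /esym/eqP.
  by rewrite oner_eq0.
have Tw k : T (w k) = - l^-1 *: w k.
  rewrite -{2}(Tlw k) linearN linearZ /= scalerN scaleNr opprK scalerA.
  by rewrite mulVf// scale1r.
pose K := closure (T @` [set x | `|x| <= 1]).
have KTw k : K (T (w k)).
  by apply: subset_closure; exists (w k) => //=; rewrite norm_unit.
have FK : ((fun k => T (w k)) @ \oo) K by exists 0%N => // k _; exact: KTw.
have [p [_ pcl]] := Tcpt _ _ FK.
pose r := `|l^-1| / 2.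
have r0 : 0 < r by rewrite divr_gt0// normr_gt0 invr_neq0.
have near_p N : exists2 k, (N <= k)%N & `|p - T (w k)| < r.
  have [] := pcl (T @` [set w k | k in [set k | (N <= k)%N]]) (ball p r).
  - exists N => //= k Nk; exists (w k) => //; by exists k.
  - exact: nbhsx_ballx.
  - move=> y [[_ [k Nk <-] <-]] /=; rewrite -ball_normE /= => pk.
    by exists k.
have [k _ pk] := near_p 0%N.
have [N orthN] := w_orth k.
have [m Nm pm] := near_p N.
have : `|T (w k) - T (w m)| < `|l^-1|.
  rewrite (_ : `|l^-1| = r + r); last by rewrite /r -splitr.
  by apply: le_lt_trans (ler_distD p _ _) _; rewrite ltrD// distrC.
rewrite !Tw -scalerBr normrZ normrN gtr_pMr ?normr_gt0 ?invr_neq0//.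
rewrite -(@ltr_pXn2r _ 2)// ?nnegrE// dot_norm expr1n.
rewrite linearBl !linearBr /= !w1 orthN// dotC orthN// conjC0 subr0 sub0r opprK.
by rewrite gtrDl ltr10.
Qed.

End UnitVectors.

(** * Commutators with a diagonal operator *)

Section DiagonalGraph.
Context {R : realType} {H : completeNormedModType R[i]}.
Variable dot : {dot H for (@Num.conj R[i])}.
Hypothesis dot_norm : induces_norm dot.
Variable e : int -> int -> int -> H.
Hypothesis e_basis : orthonormal_basis dot e.
Variable d : int -> int -> R.
Local Notation D := (diagonal_operator dot e d).

Lemma basis_unit n i j : valid_index n i j -> dot (e n i j) (e n i j) = 1.
Proof. by case: e_basis => eo _ _ v; rewrite eo// eqxx. Qed.

Lemma diagonal_eigen n i j : D (e n i j, (d n i)%:C *: e n i j).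
Proof.
case: e_basis => eo _ e0 n' i' j' v' /=; rewrite dotZl.
have [v|v] := boolP (valid_index n i j); last by rewrite e0// linear0l !mulr0.
by rewrite eo//; case: eqVneq => [[-> -> _]//|]; rewrite !mulr0.
Qed.

Lemma diagonal_comb a b x x' y y' :
  D (x, y) -> D (x', y') -> D (a *: x + b *: x', a *: y + b *: y').
Proof.
move=> Dx Dx' n i j v /=; rewrite !linearDl /= !dotZl.
by rewrite (Dx _ _ _ v) (Dx' _ _ _ v) /= mulrDr !(mulrCA (d n i)%:C).
Qed.

(** The coefficient of [[D, a] (e n i j)] on [e n1 i1 j1] is
    [A * (d n1 i1 - d n i)], and [e n i j] is a unit vector. The index
    [(n2, i2, j2)] may be out of range, where [e] vanishes. *)
Lemma commutator_coef (a : {linear H -> H}) (C A B : R)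
    n i j n1 i1 j1 n2 i2 j2 :
  (forall x z, commutator D a (x, z) -> `|z| <= C%:C * `|x|) ->
  valid_index n i j -> valid_index n1 i1 j1 -> n1 != n2 ->
  a (e n i j) = A%:C *: e n1 i1 j1 + B%:C *: e n2 i2 j2 ->
  `|A| * `|d n1 i1 - d n i| <= C.
Proof.
move=> Ca v v1 n12 ae.
set w := A%:C *: ((d n1 i1)%:C *: e n1 i1 j1) +
         B%:C *: ((d n2 i2)%:C *: e n2 i2 j2).
have /Ca : commutator D a (e n i j, w - a ((d n i)%:C *: e n i j)).
  exists ((d n i)%:C *: e n i j), w; split => //=; first exact: diagonal_eigen.
  by rewrite ae; apply: diagonal_comb; apply: diagonal_eigen.
rewrite (norm_unit _ dot_norm _ (basis_unit _ _ _ v)) mulr1.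
move=> /(le_trans (dot_unit_le _ dot_norm _ _ (basis_unit _ _ _ v1))).
have e21 : dot (e n2 i2 j2) (e n1 i1 j1) = 0.
  case: e_basis => eo _ e0.
  have [v2|v2] := boolP (valid_index n2 i2 j2); last by rewrite e0// linear0l.
  rewrite eo//; case: eqVneq => // -[n21 _ _].
  by move: n12; rewrite n21 eqxx.
rewrite linearZ /= ae linearBl /= /w linearDl /= !dotZl linearDl /= !dotZl.
rewrite basis_unit// e21 !mulr0 !addr0 !mulr1 (mulrC A%:C).
rewrite -mulrBl -rmorphB -rmorphM /=.
rewrite normc_def /= expr0n /= addr0 sqrtr_sqr lecR normrM mulrC.
exact.
Qed.
End DiagonalGraph.

(** * The coefficients of the generators *)

(** A valid index is given by [n = m], [i = 2 b - m] and [j = 2 c - m] with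
    natural numbers [b] and [c] at most [m], the indices being doubled; this is the
    parametrization used from here on, in which [b] is the coordinate [n + i] of
    the undoubled indices. *)
Lemma valid_index_corner (m b c : nat) : (b <= m)%N -> (c <= m)%N ->
  valid_index m (b.*2%:Z - m%:Z) (c.*2%:Z - m%:Z).
Proof.
move=> bm cm.
have hd (x : nat) : (x <= m)%N -> (2 %| m%:Z - (x.*2%:Z - m%:Z))%Z.
  move=> xm; have -> : m%:Z - (x.*2%:Z - m%:Z) = (m%:Z - x%:Z) * 2 by lia.
  exact: dvdz_mull.
have hn (x : nat) : (x <= m)%N -> `|x.*2%:Z - m%:Z| <= m%:Z by lia.
by rewrite /valid_index !hd// !hn.
Qed.

Section Coefficients.
Context {R : realType} (q : R).
Hypothesis q01 : 0 < q < 1.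

Lemma sub1_exprz_ge (k : nat) : 1 - q ^+ 2 <= 1 - q ^ k.+2%:Z.
Proof.
case/andP: q01 => q0 q1; rewrite lerB// -exprnP ler_wiXn2l//; exact: ltW.
Qed.

Lemma sub1_sqr_gt0 : 0 < 1 - q ^+ 2.
Proof. by case/andP: q01 => q0 q1; rewrite subr_gt0 expr_lt1// ltW. Qed.

Lemma sub1_exprz_gt0 (k : nat) : 0 < 1 - q ^ k.+2%:Z.
Proof. exact: lt_le_trans sub1_sqr_gt0 (sub1_exprz_ge k). Qed.

Lemma ratio_ge (k m : nat) : 1 - q ^+ 2 <= (1 - q ^ k.+2%:Z) / (1 - q ^ m.+2%:Z).
Proof.
rewrite ler_pdivlMr ?sub1_exprz_gt0//.
apply: le_trans (sub1_exprz_ge k); rewrite ler_piMr//; first exact/ltW/sub1_sqr_gt0.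
by rewrite gerBl -exprnP exprn_ge0//; case/andP: q01 => /ltW.
Qed.

(** At [j = - n] the power of [q] in [b_plus] disappears, whatever [i] is. *)
Lemma b_plus_ge (m b : nat) : (b <= m)%N ->
  Num.sqrt (1 - q ^+ 2) <= `|b_plus q m (b.*2%:Z - m%:Z) (- m%:Z)|.
Proof.
move=> bm; rewrite /b_plus normrN ger0_norm ?sqrtr_ge0// ler_wsqrtr//.
rewrite subrr expr0z mul1r opprK.
have -> : m%:Z + m%:Z + 2 = m.*2.+2%:Z by lia.
have -> : 2 * m%:Z + 2 = m.*2.+2%:Z by lia.
have -> : m%:Z + (b.*2%:Z - m%:Z) + 2 = b.*2.+2%:Z by lia.
have -> : 2 * m%:Z + 4 = m.*2.+4%:Z by lia.
rewrite -mulf_div divff ?mul1r; first exact: ratio_ge.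
by rewrite gt_eqF// sub1_exprz_gt0.
Qed.

(** The power of [q] in [a_plus] grows with [n + i] and [n + j]; it does not
    depend on [n] in the corner [i = j = - n]. *)
Lemma a_plus_ge (m : nat) :
  q * Num.sqrt (1 - q ^+ 2) <= `|a_plus q m (- m%:Z) (- m%:Z)|.
Proof.
case/andP: (q01) => q0 q1.
rewrite /a_plus ger0_norm ?sqrtr_ge0// subrr !add0r opprK.
have -> : m%:Z + m%:Z + 2 = m.*2.+2%:Z by lia.
have -> : 2 * m%:Z + 2 = m.*2.+2%:Z by lia.
have -> : 2 * m%:Z + 4 = m.*2.+4%:Z by lia.
rewrite -mulf_div divff ?mul1r; last by rewrite gt_eqF// sub1_exprz_gt0.
rewrite -(exprnP q 2) sqrtrM ?exprn_ge0 ?(ltW q0)// sqrtr_sqr gtr0_norm//.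
by rewrite ler_wpM2l ?(ltW q0)// ler_wsqrtr// ratio_ge.
Qed.

End Coefficients.

(** * Linear growth of the eigenvalues *)

Section Growth.
Context {R : realType} {q : R}.
Hypothesis q01 : 0 < q < 1.
Context {H : completeNormedModType R[i]}.
Variable dot : {dot H for (@Num.conj R[i])}.
Hypothesis dot_norm : induces_norm dot.
Variable e : int -> int -> int -> H.
Hypothesis e_basis : orthonormal_basis dot e.
Variables alpha beta : {linear H -> H}.
Hypothesis gen : suq2_generators q e alpha beta.
Variable d : int -> int -> R.
Local Notation D := (diagonal_operator dot e d).

Lemma beta_step : bounded_commutator D beta ->
  exists2 K, 0 <= K & forall m b : nat, (b <= m)%N ->
    `|d m.+1 (b.+1.*2%:Z - m.+1%:Z) - d m (b.*2%:Z - m%:Z)| <= K.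
Proof.
move=> [_ [C hC]]; exists (`|C| / Num.sqrt (1 - q ^+ 2)) => [|m b bm].
  by rewrite divr_ge0// sqrtr_ge0.
have s0 : 0 < Num.sqrt (1 - q ^+ 2) by rewrite sqrtr_gt0 sub1_sqr_gt0.
rewrite ler_pdivlMr// mulrC.
have v := valid_index_corner m b 0 bm isT; rewrite sub0r in v.
have v1 := valid_index_corner m.+1 b.+1 0 bm isT; rewrite sub0r in v1.
case: gen => _ _ _ /(_ _ _ _ v); move=> be.
apply: le_trans (ler_norm C).
apply: le_trans (commutator_coef _ dot_norm e e_basis d beta C
  (b_plus q m (b.*2%:Z - m%:Z) (- m%:Z)) (b_minus q m (b.*2%:Z - m%:Z) (- m%:Z))
  _ _ _ _ _ _ (m%:Z - 1) (b.*2%:Z - m%:Z + 1) (- m%:Z - 1) hC v v1 _ _).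
- by rewrite ler_wpM2r// b_plus_ge.
- lia.
- rewrite be; congr (_ *: e _ _ _ + _); lia.
Qed.

Lemma alpha_step : bounded_commutator D alpha ->
  exists2 K, 0 <= K & forall m : nat,
    `|d m.+1 (- m.+1%:Z) - d m (- m%:Z)| <= K.
Proof.
case/andP: (q01) => q0 q1.
move=> [_ [C hC]]; exists (`|C| / (q * Num.sqrt (1 - q ^+ 2))) => [|m].
  by rewrite divr_ge0// mulr_ge0 ?sqrtr_ge0// ltW.
have s0 : 0 < q * Num.sqrt (1 - q ^+ 2).
  by rewrite mulr_gt0// sqrtr_gt0 sub1_sqr_gt0.
rewrite ler_pdivlMr// mulrC.
have v := valid_index_corner m 0 0 isT isT; rewrite sub0r in v.
have v1 := valid_index_corner m.+1 0 0 isT isT; rewrite sub0r in v1.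
case: gen => _ _ /(_ _ _ _ v) ae _.
apply: le_trans (ler_norm C).
apply: le_trans (commutator_coef _ dot_norm e e_basis d alpha C
  (a_plus q m (- m%:Z) (- m%:Z)) (a_minus q m (- m%:Z) (- m%:Z))
  _ _ _ _ _ _ (m%:Z - 1) (- m%:Z - 1) (- m%:Z - 1) hC v v1 _ _).
- by rewrite ler_wpM2r// a_plus_ge.
- lia.
- rewrite ae; congr (_ *: e _ _ _ + _); lia.
Qed.

(** [alpha] gives the steps along the boundary [b = 0], [beta] those which
    increase [b]. *)
Lemma linear_growth : bounded_commutator D alpha -> bounded_commutator D beta ->
  exists2 K, 0 < K & forall m b : nat, (b <= m)%N ->
    `|d m (b.*2%:Z - m%:Z)| <= K * m.+1%:R.
Proof.
move=> /alpha_step[Ka Ka0 hKa] /beta_step[Kb Kb0 hKb].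
exists (1 + `|d 0 0| + Ka + Kb) => [|m b].
  by have := normr_ge0 (d 0 0); lra.
set K := _ + Kb.
have KaK : Ka <= K by rewrite /K; have := normr_ge0 (d 0 0); lra.
have KbK : Kb <= K by rewrite /K; have := normr_ge0 (d 0 0); lra.
have step (x y c : R) n : `|x - y| <= c -> c <= K -> `|y| <= K * n.+1%:R ->
    `|x| <= K * n.+2%:R.
  move=> xy cK yK; rewrite -(subrK y x); apply: le_trans (ler_normD _ _) _.
  by rewrite -[n.+2%:R]natr1; have := le_trans xy cK; lra.
elim: b m => [|b IH] m bm.
  rewrite sub0r; elim: m {bm} => [|m IH]; last exact: step (hKa m) KaK IH.
  by rewrite oppr0 mulr1 /K; have := normr_ge0 (d 0 0); lra.
case: m bm => // m bm; exact: step (hKb m b bm) KbK (IH m bm).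
Qed.

End Growth.

(** * Power growth against logarithmic growth *)

Section Asymptotics.
Context {R : realType}.

Lemma ln_le_powR (s x : R) : 0 < s -> 0 < x -> ln x <= s^-1 * x `^ s.
Proof.
move=> s0 x0; rewrite mulrC ler_pdivlMr// mulrC -ln_powR.
exact/ltW/ln_sublinear/powR_gt0.
Qed.

(** The sum of the first [L ^ 3] terms is at least [K ^ - p * L ^ (3 - p)].
    Put [3 - p = 2 s]: since [ln L <= s^-1 * L ^ s], a bound [O(ln (L ^ 3))] makes
    [L ^ s] bounded. *)
Lemma cubic_decay_not_logarithmic (mu : nat -> R) (p K : R) (M : nat) :
  p < 3 -> 0 < K ->
  (forall L k, (M <= L)%N -> (k < L ^ 3)%N -> (K * L%:R) `^ (- p) <= mu k) ->
  ~ (fun N : nat => \sum_(k < N) mu k : R^o) =O_\oo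
    (fun N : nat => ln N%:R : R^o).
Proof.
move=> p3 K0 muge /eqO_exP[B B0 [N0 _ hB]].
pose s := (3 - p) / 2; have s0 : 0 < s by rewrite /s; lra.
(* [A] is the bound which the assumption would impose on [L ^ s]. *)
pose A := B * 3 * s^-1 * K `^ p.
have A0 : 0 < A by rewrite /A !mulr_gt0// ?invr_gt0// powR_gt0.
pose L := (maxn (maxn 1 (maxn M N0)) (Num.bound (A `^ s^-1))).
have L1 : (0 < L)%N by rewrite /L; lia.
have LM : (M <= L)%N by rewrite /L; lia.
have LN : (N0 <= L ^ 3)%N.
  by apply: (@leq_trans L); [rewrite /L; lia|rewrite -{1}(expn1 L) leq_pexp2l].
have Lr0 : 0 < L%:R :> R by rewrite ltr0n.
have LA : A < L%:R `^ s.
  have -> : A = (A `^ s^-1) `^ s by rewrite -powRrM mulVf ?gt_eqF// powRr1// ltW.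
  apply: gt0_ltr_powR => //; rewrite ?nnegrE ?powR_ge0//.
  apply: lt_le_trans (archi_boundP (powR_ge0 _ _)) _.
  by rewrite ler_nat /L leq_maxr.
have sum_ge : (L ^ 3)%:R * (K * L%:R) `^ (- p) <= \sum_(k < L ^ 3) mu k.
  rewrite mulr_natl -[X in _ *+ X]card_ord -sumr_const.
  by apply: ler_sum => k _; apply: muge.
have := hB _ LN; rewrite /= => /(le_trans (ler_norm _))/(le_trans sum_ge).
rewrite ger0_norm; last by rewrite ln_ge0// ler1n expn_gt0 L1.
rewrite natrX lnXn// -[ln _ *+ 3]mulr_natl mulrA => le1.
have := le_trans le1 (ler_wpM2l _ (ln_le_powR s _ s0 Lr0)).
rewrite mulr_ge0 ?(ltW B0)// => /(_ isT).
rewrite -powR_mulrn ?(ltW Lr0)// powRM ?(ltW K0) ?(ltW Lr0)//.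
rewrite (powRN K) mulrCA -powRD; last by rewrite (gt_eqF Lr0) implybT.
rewrite ler_pdivrMl ?powR_gt0//.
have -> : 3%:R - p = s + s :> R by rewrite /s; lra.
rewrite powRD; last by rewrite (gt_eqF Lr0) implybT.
rewrite (_ : _ * (_ * _) = A * L%:R `^ s); last by rewrite /A; ring.
by rewrite ler_pM2r ?powR_gt0// leNgt LA.
Qed.
End Asymptotics.

(** * Summability *)

Section Kernel.
Context {R : realType} {H : completeNormedModType R[i]}.
Variable dot : {dot H for (@Num.conj R[i])}.
Hypothesis dot_norm : induces_norm dot.
Variable e : int -> int -> int -> H.
Hypothesis e_basis : orthonormal_basis dot e.
Variable d : int -> int -> R.
Local Notation D := (diagonal_operator dot e d).

(** Otherwise the kernel contains basis vectors of arbitrarily large [n], and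
    two basis vectors with different [n] are orthogonal. *)
Lemma eigenvalue_eventually_neq0 : has_compact_resolvent D ->
  exists M : nat, forall m b : nat, (M <= m)%N -> (b <= m)%N ->
    d m (b.*2%:Z - m%:Z) != 0.
Proof.
move=> cr; apply: contrapT => noM.
have zero M : exists mb : nat * nat,
    [/\ (M <= mb.1)%N, (mb.2 <= mb.1)%N & d mb.1 (mb.2.*2%:Z - mb.1%:Z) = 0].
  apply: contrapT => nz; apply: noM; exists M => m b Mm bm; apply/eqP => d0.
  by apply: nz; exists (m, b).
have [f hf] := choice zero.
have v k : valid_index (f k).1 ((f k).2.*2%:Z - (f k).1%:Z) (- (f k).1%:Z).
  by have [_ bm _] := hf k; have := valid_index_corner _ _ 0 bm isT; rewrite sub0r.
pose w k := e (f k).1 ((f k).2.*2%:Z - (f k).1%:Z) (- (f k).1%:Z).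
apply: (compact_resolvent_no_kernel_sequence _ dot_norm D w cr) => [k|k|k].
- exact: basis_unit.
- have [_ _ d0] := hf k; have := diagonal_eigen _ _ e_basis d (f k).1
    ((f k).2.*2%:Z - (f k).1%:Z) (- (f k).1%:Z).
  by rewrite d0 scale0r.
exists (f k).1.+1 => l kl; case: e_basis => eo _ _; rewrite /w eo//.
have [fl _ _] := hf l; case: eqVneq => // -[kl' _ _].
by move: (leq_trans kl fl); rewrite kl' ltnn.
Qed.
End Kernel.

Theorem theorem3p6 (R : realType) (q : R) (hq : 0 < q < 1)
    (H : completeNormedModType R[i])
    (dot : {dot H for (@Num.conj R[i])}) (hdot : induces_norm dot)
    (e : int -> int -> int -> H) (he : orthonormal_basis dot e)
    (alpha beta : {linear H -> H}) (hgen : suq2_generators q e alpha beta)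
    (D : set (H * H))
    (hD : odd_spectral_triple dot (star_algebra dot alpha beta) D)
    (heq : equivariant dot e D)
    (p : R) (hp0 : 0 < p) (hp3 : p < 3) :
  ~ p_summable dot D p.
Proof.
case: heq => d dD; subst D; case: hD => _ cr comm.
have [K K0 dK] := linear_growth hq _ hdot _ he _ _ hgen d
  (comm _ (star_algebra_alpha _ _ _)) (comm _ (star_algebra_beta _ _ _)).
have [M d_neq0] := eigenvalue_eventually_neq0 _ hdot _ he d cr.
move=> [T [_ Tpow [_ [mu sv]]]].
pose I := {t : int * int * int | valid_index t.1.1 t.1.2 t.2}.
pose u (t : I) := e (val t).1.1 (val t).1.2 (val t).2.
pose lam (t : I) := let l := d (val t).1.1 (val t).1.2 in
  if l == 0 then 0 else `|l| `^ (- p).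
have [eo etot _] := he.
have u_orth : orthonormal_family dot u.
  have tripleE (x : int * int * int) : (x.1.1, x.1.2, x.2) = x.
    by case: x => [[]].
  by move=> s t; rewrite /u eo ?(valP s) ?(valP t)// !tripleE.
have u_tot x : (forall t, dot x (u t) = 0) -> x = 0.
  by move=> xu; apply: etot => n i j v; exact: (xu (exist _ (n, i, j) v)).
have T_diag t : T (u t) = (lam t)%:C *: u t.
  exact/Tpow/diagonal_eigen.
(* The [L ^ 3] vectors are those with [n = L + a], [b < L] and [c < L] for
   [a < L]; since [n < 2 L], the eigenvalues of [D] on them are at most [3 K L]
   in absolute value. *)
apply: (cubic_decay_not_logarithmic mu p (3 * K) (maxn M 1)) => //.
  by rewrite mulr_gt0.
move=> L k; rewrite geq_max => /andP[ML L1] kL.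
have v (t : 'I_L * 'I_L * 'I_L) : valid_index (L + t.1.1)%N
    (t.1.2.*2%:Z - (L + t.1.1)%N%:Z) (t.2.*2%:Z - (L + t.1.1)%N%:Z).
  by apply: valid_index_corner; apply: ltnW; apply: ltn_addr.
pose h t : I := exist _ (_, _, _) (v t).
apply: (singular_value_ge dot u u_orth u_tot T lam T_diag h _ mu k _ _ _ sv).
- move=> [[a b] c] [[a' b'] c'] /(congr1 val) /= [aa bb cc].
  by congr (_, _, _); apply: val_inj => /=; lia.
- by rewrite powR_gt0// !mulr_gt0// ltr0n.
- move=> t; rewrite /lam /=.
  have bm : (t.1.2 <= L + t.1.1)%N by apply: ltnW; apply: ltn_addr.
  have Mm : (M <= L + t.1.1)%N by apply: leq_trans ML (leq_addr _ _).
  have dn0 := d_neq0 _ _ Mm bm; rewrite (negbTE dn0).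
  rewrite !powRN lef_pV2 ?posrE ?powR_gt0 ?normr_gt0 ?mulr_gt0 ?ltr0n//.
  apply: ge0_ler_powR; rewrite ?nnegrE ?(ltW hp0) ?mulr_ge0 ?(ltW K0)//.
  apply: le_trans (dK _ _ bm) _.
  rewrite (mulrC 3) -mulrA ler_pM2l// -natrM ler_nat.
  have := ltn_ord t.1.1; lia.
by rewrite !card_prod card_ord; move: kL; rewrite !expnS expn0 muln1 mulnA.
Qed.
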